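(* Let $\Lambda_1,\dots,\Lambda_m>0$ be pairwise distinct constants and let the CFL condition $\frac{\Delta t}{\Delta x}\max_{i=1,\dots,m}\Lambda_i\le1$ hold. For any $\kappa_i$, $i=1,\dots,m$, such that $0<\kappa_i<1$, there exist $\mu_i>0$, $i=1,\dots,m$, with $\mu_i\le\ln(\kappa_i^{-2})$, such that for all initial data $u^{(i),0}_{j,k}$ the numerical solution $u^{(i),n}_{j,k}$ defined by the upwind scheme satisfies $$\mathcal{L}^n\le e^{-\nu t^n}\mathcal{L}^0,\quad n=0,\dots,N,\qquad \nu=\min_{i=1,\dots,m}\big\{\Lambda_i\mu_ie^{-\mu_i\Delta x}\big\},$$ where $$\mathcal{L}^n=\Delta x\,\Delta\xi\sum_{i=1}^m\sum_{j=1}^M\sum_{k=1}^K\big(u^{(i),n}_{j,k}\big)^2e^{-\mu_ix_j}\rho(\xi_k).$$ Furthermore, the numerical solution is exponentially stable in the discrete $L^2$-norm: for $n=0,\dots,N$, $$\Delta x\,\Delta\xi\sum_{i=1}^m\sum_{j=1}^M\sum_{k=1}^K\big(u^{(i),n}_{j,k}\big)^2\rho(\xi_k)\le\max_{i=1,\dots,m}e^{\mu_ix_M-\nu t^n}\ \Delta x\,\Delta\xi\sum_{i=1}^m\sum_{j=1}^M\sum_{k=1}^K\big(u^{(i),0}_{j,k}\big)^2\rho(\xi_k).$$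
   Context: The scheme discretizes the linear diagonal random hyperbolic system $u^{(i)}_t+\Lambda_iu^{(i)}_x=0$, $i=1,\dots,m$, $x\in[0,1]$, with random variable $\xi$ having probability density function $\rho\ge0$ and feedback boundary condition $u^{(i)}(t,0,\xi)=\kappa_iu^{(i)}(t,1,\xi)$. Grid. $x_j=j\Delta x$, $j=0,\dots,M$, with $M\Delta x=1$; $\xi_k$, $k=0,\dots,K$, with $\xi_{k+1}-\xi_k=\Delta\xi>0$; $t^n=n\Delta t$, $n=0,\dots,N$. Upwind scheme. Given initial values $u^{(i),0}_{j,k}$ for $j=1,\dots,M$, $k=0,\dots,K$, $i=1,\dots,m$, set $u^{(i),0}_{0,k}=\kappa_iu^{(i),0}_{M,k}$, and for $n\ge0$ $$u^{(i),n+1}_{j,k}=u^{(i),n}_{j,k}-\frac{\Delta t}{\Delta x}\Lambda_i\big(u^{(i),n}_{j,k}-u^{(i),n}_{j-1,k}\big),\quad j=1,\dots,M,\qquad u^{(i),n+1}_{0,k}=\kappa_iu^{(i),n+1}_{M,k}.$$ *)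

(* Defs.v *)
From HB Require Import structures.
From mathcomp Require Import all_boot all_order all_algebra.
From mathcomp Require Import all_classical all_reals all_analysis.

Set Implicit Arguments.
Unset Strict Implicit.
Unset Printing Implicit Defensive.

Import Order.TTheory GRing.Theory Num.Theory.
Import numFieldNormedType.Exports.

Local Open Scope ring_scope.

(* The components are indexed by 'I_m.+1: the system has m.+1 >= 1 equations,
   so that maxima and minima over the components are over a nonempty family. *)
Definition fmax (R : realType) (m : nat) (F : 'I_m.+1 -> R) : R :=
  \big[Num.max/F ord0]_(i < m.+1) F i.

Definition fmin (R : realType) (m : nat) (F : 'I_m.+1 -> R) : R :=
  \big[Num.min/F ord0]_(i < m.+1) F i.

Definition is_pdf (R : realType) (rho : R -> R) : Prop :=
  [/\ measurable_fun [set: R] rho,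
      (forall x, 0 <= rho x) &
      (\int[@lebesgue_measure R]_x (rho x)%:E = 1)%E].

Section scheme.
Variables (R : realType) (m M : nat) (dt dx : R).
Variables (Lambda kappa : 'I_m.+1 -> R).

(* [upwind u0 n i j k] is the value at time n dt of component i at (x_j, xi_k).
   Of the total function [u0], only the values at 1 <= j <= M are initial data:
   the value at j = 0 is set by the feedback boundary condition, and the values
   at j > M never influence those at j <= M. *)
Fixpoint upwind (u0 : 'I_m.+1 -> nat -> nat -> R) (n : nat)
    (i : 'I_m.+1) (j k : nat) : R :=
  match n with
  | 0%N => if j == 0%N then kappa i * u0 i M k else u0 i j k
  | n'.+1 =>
      let u := upwind u0 n' in
      let interior l := u i l k - dt / dx * Lambda i * (u i l k - u i l.-1 k) in
      if j == 0%N then kappa i * interior M else interior j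
  end.

Lemma upwind_init u0 i j k : (0 < j)%N -> upwind u0 0 i j k = u0 i j k.
Proof. by case: j. Qed.

Lemma upwind_interior u0 n i j k : (0 < j)%N ->
  upwind u0 n.+1 i j k =
  upwind u0 n i j k
  - dt / dx * Lambda i * (upwind u0 n i j k - upwind u0 n i j.-1 k).
Proof. by case: j. Qed.

Lemma upwind_boundary u0 n i k : (0 < M)%N ->
  upwind u0 n i 0 k = kappa i * upwind u0 n i M k.
Proof. by case: n => [|n] /=; case: M. Qed.

End scheme.

Definition decay_rate (R : realType) (m : nat) (dx : R)
    (Lambda mu : 'I_m.+1 -> R) : R :=
  fmin (fun i => Lambda i * mu i * expR (- (mu i * dx))).

Definition lyapunov (R : realType) (m M K : nat) (dx dxi : R) (xi : nat -> R)
    (rho : R -> R) (mu : 'I_m.+1 -> R) (u : 'I_m.+1 -> nat -> nat -> R) : R :=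
  dx * dxi * \sum_(i < m.+1) \sum_(1 <= j < M.+1) \sum_(1 <= k < K.+1)
    u i j k ^+ 2 * expR (- (mu i * (j%:R * dx))) * rho (xi k).

Definition sqnormL2 (R : realType) (m M K : nat) (dx dxi : R) (xi : nat -> R)
    (rho : R -> R) (u : 'I_m.+1 -> nat -> nat -> R) : R :=
  dx * dxi * \sum_(i < m.+1) \sum_(1 <= j < M.+1) \sum_(1 <= k < K.+1)
    u i j k ^+ 2 * rho (xi k).

(* Main.v *)
(* By the CFL condition each updated value is a convex combination of a value
   and its left neighbour, so squaring is a contraction by convexity.  With the
   weights exp (- mu_i x_j), shifting the index costs a factor exp (- mu_i dx),
   and kappa_i ^ 2 <= exp (- mu_i) absorbs the boundary term; one may take
   mu_i = ln (kappa_i ^ -2).  The contraction factor of one step is then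
   1 - dt / dx * Lambda_i * (1 - exp (- mu_i dx)) <= 1 - nu dt <= exp (- nu dt),
   since 1 - exp (- y) >= y exp (- y). *)
Require Import Defs.
From mathcomp Require Import all_boot all_order all_algebra.
From mathcomp Require Import all_classical all_reals all_analysis.
From mathcomp Require Import ring lra.

Set Implicit Arguments.
Unset Strict Implicit.
Unset Printing Implicit Defensive.

Import Order.TTheory GRing.Theory Num.Theory.
Import numFieldNormedType.Exports.

Local Open Scope ring_scope.

(** Reindexing extracts a factor [q] and leaves a sum over [0 <= j < M]. It differs from the sum
    over [1 <= j <= M] only in having the term at 0 in place of the term at [M], and the hypothesis
    on [v 0] compares exactly these two. *)
Lemma weighted_shift_sum_le (R : realDomainType) (M : nat) (q : R)
    (v : nat -> R) : 0 <= q -> v 0%N ^+ 2 <= q ^+ M * v M ^+ 2 ->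
  \sum_(1 <= j < M.+1) v j.-1 ^+ 2 * q ^+ j
    <= q * \sum_(1 <= j < M.+1) v j ^+ 2 * q ^+ j.
Proof.
move=> q0 vM.
have -> : \sum_(1 <= j < M.+1) v j.-1 ^+ 2 * q ^+ j =
    q * \sum_(0 <= j < M) v j ^+ 2 * q ^+ j.
  rewrite big_add1 mulr_sumr; apply: eq_bigr => j _ /=.
  by rewrite [q ^+ _]exprS mulrCA.
apply: ler_wpM2l => //.
have e : \sum_(0 <= j < M) v j ^+ 2 * q ^+ j + v M ^+ 2 * q ^+ M =
    v 0%N ^+ 2 + \sum_(0 <= j < M) v j.+1 ^+ 2 * q ^+ j.+1.
  by rewrite -big_nat_recr // big_nat_recl // expr0 mulr1.
by rewrite -(lerD2r (v M ^+ 2 * q ^+ M)) e big_add1 addrC lerD2l mulrC.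
Qed.

Lemma sqr_convex_comb_le (R : realDomainType) (t x y : R) : 0 <= t <= 1 ->
  (x - t * (x - y)) ^+ 2 <= (1 - t) * x ^+ 2 + t * y ^+ 2.
Proof.
move=> /andP[t0 t1]; rewrite -subr_ge0.
have -> : (1 - t) * x ^+ 2 + t * y ^+ 2 - (x - t * (x - y)) ^+ 2 =
    t * (1 - t) * (x - y) ^+ 2 by ring.
by rewrite mulr_ge0 ?sqr_ge0 ?mulr_ge0 ?subr_ge0.
Qed.

(** One time step for a single component and a single [xi k]: [t] stands for the Courant number
    [dt / dx * Lambda i], and [q] for the ratio of consecutive weights. *)
Lemma upwind_step_sum_le (R : realDomainType) (M : nat) (t q : R)
    (v : nat -> R) : 0 <= t <= 1 -> 0 <= q ->
  v 0%N ^+ 2 <= q ^+ M * v M ^+ 2 ->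
  \sum_(1 <= j < M.+1) (v j - t * (v j - v j.-1)) ^+ 2 * q ^+ j
    <= (1 - t * (1 - q)) * \sum_(1 <= j < M.+1) v j ^+ 2 * q ^+ j.
Proof.
move=> t01 q0 vM; have /andP[t0 t1] := t01.
apply: (@le_trans _ _ (\sum_(1 <= j < M.+1)
   ((1 - t) * (v j ^+ 2 * q ^+ j) + t * (v j.-1 ^+ 2 * q ^+ j)))).
  apply: ler_sum => j _; rewrite [leRHS](_ : _ =
    ((1 - t) * v j ^+ 2 + t * v j.-1 ^+ 2) * q ^+ j); last by ring.
  by rewrite ler_wpM2r ?exprn_ge0 ?sqr_convex_comb_le.
rewrite big_split /= -!mulr_sumr.
have -> : 1 - t * (1 - q) = 1 - t + t * q by ring.
by rewrite [leRHS]mulrDl lerD2l -mulrA ler_wpM2l ?weighted_shift_sum_le.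
Qed.

Lemma mulr_expRN_le (R : realType) (y : R) : y * expR (- y) <= 1 - expR (- y).
Proof.
(* This is [1 + y <= expR y] divided by [expR y]. *)
have : (1 + y) * expR (- y) <= 1.
  by rewrite expRN ler_pdivrMr ?expR_gt0 // mul1r expR_ge1Dx.
by lra.
Qed.

Lemma le_fmax (R : realType) (m : nat) (F : 'I_m.+1 -> R) i : F i <= fmax F.
Proof. exact: le_bigmax. Qed.

Lemma fmin_le (R : realType) (m : nat) (F : 'I_m.+1 -> R) i : fmin F <= F i.
Proof. exact: bigmin_le. Qed.

Section lyapunov_decay.
Variables (R : realType) (m M K : nat) (dt dx dxi : R).
Variables (xi : nat -> R) (rho : R -> R) (Lambda kappa mu : 'I_m.+1 -> R).
Hypotheses (rho_ge0 : forall x, 0 <= rho x) (dt_gt0 : 0 < dt).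
Hypotheses (dx_gt0 : 0 < dx) (dxi_gt0 : 0 < dxi) (M_gt0 : (0 < M)%N).
Hypotheses (Mdx : M%:R * dx = 1) (Lambda_ge0 : forall i, 0 <= Lambda i).
Hypothesis CFL : dt / dx * fmax Lambda <= 1.
Hypothesis mu_ge0 : forall i, 0 <= mu i.
Hypothesis kappa_mu : forall i, kappa i ^+ 2 <= expR (- mu i).

Let nu := decay_rate dx Lambda mu.
Let L := lyapunov M K dx dxi xi rho mu.
Let S := @sqnormL2 R m M K dx dxi xi rho.

(** On the uniform grid the weights are geometric in [j], which reduces the step to the purely
    algebraic estimate on powers of [q]. *)
Lemma expR_weight i j :
  expR (- (mu i * (j%:R * dx))) = expR (- (mu i * dx)) ^+ j.
Proof. by rewrite -expRM_natl; congr expR; ring. Qed.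

Lemma contraction_factor_le i :
  1 - dt / dx * Lambda i * (1 - expR (- (mu i * dx))) <= expR (- (nu * dt)).
Proof.
apply: le_trans (expR_ge1Dx _); rewrite lerD2l lerN2.
apply: (@le_trans _ _ (Lambda i * mu i * expR (- (mu i * dx)) * dt)).
  by rewrite ler_wpM2r ?(ltW dt_gt0) // /nu; exact: fmin_le.
have -> : Lambda i * mu i * expR (- (mu i * dx)) * dt =
   dt / dx * Lambda i * (mu i * dx * expR (- (mu i * dx))).
  by field; rewrite gt_eqF.
apply: ler_wpM2l; last exact: mulr_expRN_le.
by rewrite mulr_ge0 // divr_ge0 ?ltW.
Qed.

Lemma lyapunov_step u0 n : L (upwind M dt dx Lambda kappa u0 n.+1)
  <= expR (- (nu * dt)) * L (upwind M dt dx Lambda kappa u0 n).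
Proof.
rewrite /L /lyapunov mulrCA ler_wpM2l ?mulr_ge0 ?(ltW dx_gt0) ?(ltW dxi_gt0) //.
rewrite mulr_sumr; apply: ler_sum => i _.
(* The scheme does not couple different [k]: with the sum over [j] innermost, [rho (xi k)] is a
   common nonnegative factor. *)
rewrite exchange_big [X in _ <= _ * X]exchange_big mulr_sumr.
apply: ler_sum => k _; rewrite -!mulr_suml mulrA ler_wpM2r //.
set v := fun j => upwind M dt dx Lambda kappa u0 n i j k.
set q := expR (- (mu i * dx)).
(* The range of [j] must be kept here, since the interior update holds only for [0 < j]. *)
rewrite (eq_big_nat _ _ (F2 := fun j =>
  (v j - dt / dx * Lambda i * (v j - v j.-1)) ^+ 2 * q ^+ j)); last first.
  by move=> j /andP[j0 _]; rewrite upwind_interior // expR_weight.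
rewrite [X in _ <= _ * X](eq_bigr (fun j => v j ^+ 2 * q ^+ j)); last first.
  by move=> j _; rewrite expR_weight.
apply: le_trans (upwind_step_sum_le _ _ _) _.
- have r0 : 0 <= dt / dx by rewrite divr_ge0 ?ltW.
  rewrite mulr_ge0 //=; apply: le_trans CFL.
  by rewrite ler_wpM2l ?le_fmax.
- exact: expR_ge0.
(* As [M%:R * dx = 1], [q ^+ M] is [expR (- mu i)], so the boundary hypothesis becomes
   [kappa_mu]. *)
- rewrite /v upwind_boundary // exprMn ler_wpM2r ?sqr_ge0 //.
  by rewrite -expR_weight Mdx mulr1.
- rewrite ler_wpM2r ?contraction_factor_le //.
  by rewrite sumr_ge0 // => j _; rewrite mulr_ge0 ?sqr_ge0 ?exprn_ge0 ?expR_ge0.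
Qed.

Lemma lyapunov_decay u0 n : L (upwind M dt dx Lambda kappa u0 n)
  <= expR (- (nu * (n%:R * dt))) * L (upwind M dt dx Lambda kappa u0 0).
Proof.
elim: n => [|n IHn]; first by rewrite mul0r mulr0 oppr0 expR0 mul1r.
apply: le_trans (lyapunov_step _ _) _.
have -> : - (nu * (n.+1%:R * dt)) = - (nu * dt) - nu * (n%:R * dt).
  by rewrite -natr1; ring.
by rewrite expRD -mulrA ler_wpM2l ?expR_ge0.
Qed.

Lemma lyapunov_le_sqnormL2 u : L u <= S u.
Proof.
rewrite /L /S /lyapunov /sqnormL2.
rewrite ler_wpM2l ?mulr_ge0 ?(ltW dx_gt0) ?(ltW dxi_gt0) //.
do 3 (apply: ler_sum => ? _).
rewrite ler_wpM2r // ler_piMr ?sqr_ge0 // expR_le1 oppr_le0.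
by rewrite !mulr_ge0 // ltW.
Qed.

(** For [j <= M] one has [x_j <= 1], so every weight is at least [expR (- mu i)]. *)
Lemma sqnormL2_le_lyapunov u c : (forall i, expR (mu i) <= c) -> S u <= c * L u.
Proof.
move=> muc; rewrite /L /S /lyapunov /sqnormL2 mulrCA.
rewrite ler_wpM2l ?mulr_ge0 ?(ltW dx_gt0) ?(ltW dxi_gt0) //.
rewrite mulr_sumr; apply: ler_sum => i _.
rewrite mulr_sumr; apply: ler_sum_nat => j /andP[_ jM].
rewrite mulr_sumr; apply: ler_sum => k _.
rewrite [leRHS]mulrA ler_wpM2r // mulrCA ler_peMr ?sqr_ge0 //.
have jdx : mu i * (j%:R * dx) <= mu i.
  by rewrite ler_piMr // -[leRHS]Mdx ler_wpM2r ?(ltW dx_gt0) // ler_nat.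
apply: le_trans (ler_wpM2r (expR_ge0 _) (muc i)).
by rewrite -expRD -[leLHS]expR0 ler_expR subr_ge0.
Qed.

Lemma sqnormL2_decay u0 n : S (upwind M dt dx Lambda kappa u0 n) <=
  fmax (fun i => expR (mu i * (M%:R * dx) - nu * (n%:R * dt))) *
    S (upwind M dt dx Lambda kappa u0 0).
Proof.
set e := nu * (n%:R * dt); set c := fmax _.
(* The maximum [c] already contains the decay [expR (- e)]. Multiplying by [expR e] gives a bound on
   all [expR (mu i)], and this extra factor later cancels against the decay of [L]. *)
have c_ge i : expR (mu i) <= c * expR e.
  have -> : expR (mu i) = expR (mu i * (M%:R * dx) - e) * expR e.
    by rewrite -expRD subrK Mdx mulr1.
  rewrite ler_wpM2r ?expR_ge0 //.
  exact: (le_fmax (fun i => expR (mu i * (M%:R * dx) - e))).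
have c0 : 0 <= c.
  rewrite -(pmulr_lge0 _ (expR_gt0 e)).
  exact: le_trans (expR_ge0 _) (c_ge ord0).
apply: le_trans (sqnormL2_le_lyapunov _ c_ge) _.
apply: (@le_trans _ _ (c * L (upwind M dt dx Lambda kappa u0 0))); last first.
  by rewrite ler_wpM2l ?lyapunov_le_sqnormL2.
rewrite -mulrA ler_wpM2l //.
apply: le_trans (ler_wpM2l (expR_ge0 _) (lyapunov_decay _ _)) _.
by rewrite [leLHS]mulrA -expRD subrr expR0 mul1r.
Qed.

End lyapunov_decay.

Theorem theorem4p1 (R : realType) (m M K N : nat) (dt dx dxi : R)
    (xi : nat -> R) (rho : R -> R) (Lambda : 'I_m.+1 -> R)
    (rho_pdf : is_pdf rho)
    (dt_gt0 : 0 < dt) (dx_gt0 : 0 < dx) (dxi_gt0 : 0 < dxi)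
    (Mdx : M%:R * dx = 1)
    (xi_step : forall k, (k < K)%N -> xi k.+1 - xi k = dxi)
    (Lambda_gt0 : forall i, 0 < Lambda i)
    (Lambda_inj : injective Lambda)
    (CFL : dt / dx * fmax Lambda <= 1)
    (kappa : 'I_m.+1 -> R)
    (kappa01 : forall i, 0 < kappa i < 1) :
  exists mu : 'I_m.+1 -> R,
    (forall i, 0 < mu i /\ mu i <= ln (kappa i ^- 2)) /\
    forall u0 : 'I_m.+1 -> nat -> nat -> R,
      let u := upwind M dt dx Lambda kappa u0 in
      let nu := decay_rate dx Lambda mu in
      (forall n, (n <= N)%N ->
        lyapunov M K dx dxi xi rho mu (u n) <=
        expR (- (nu * (n%:R * dt))) * lyapunov M K dx dxi xi rho mu (u 0%N)) /\
      (forall n, (n <= N)%N ->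
        sqnormL2 M K dx dxi xi rho (u n) <=
        fmax (fun i => expR (mu i * (M%:R * dx) - nu * (n%:R * dt))) *
        sqnormL2 M K dx dxi xi rho (u 0%N)).
Proof.
have M_gt0 : (0 < M)%N.
  by case: M Mdx => // /eqP; rewrite mul0r eq_sym oner_eq0.
have [_ rho_ge0 _] := rho_pdf.
have kV_gt0 i : 0 < kappa i ^- 2.
  by have /andP[k0 _] := kappa01 i; rewrite invr_gt0 exprn_gt0.
(* The largest admissible choice, for which [kappa_mu] is an equality. *)
pose mu i := ln (kappa i ^- 2).
have mu_gt0 i : 0 < mu i.
  have /andP[k0 k1] := kappa01 i.
  by rewrite ln_gt0 // invf_gt1 ?exprn_gt0 // exprn_ilt1 // ltW.
have kappa_mu i : kappa i ^+ 2 <= expR (- mu i).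
  by rewrite expRN lnK ?posrE // invrK.
exists mu; split=> [i|u0 u nu]; first by rewrite mu_gt0.
split=> n _.
- by apply: lyapunov_decay => // i; exact: ltW.
- by apply: sqnormL2_decay => // i; exact: ltW.
Qed.
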